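(* Let $\epsilon>0$, let $\mathcal{Z}$ be a finite nonempty set, and let $\rho:\mathcal{X}\times\mathcal{Z}\to\mathbb{R}$ be a rating function with sensitivity $\Delta>0$. Take any fixed $x\in\mathcal{X}$ and put $\hat\rho_x:=\max_{z\in\mathcal{Z}}\rho(x,z)$ and $\check\rho_x:=\min_{z\in\mathcal{Z}}\rho(x,z)$. For a desired minimum rating $\tau\in[\check\rho_x,\hat\rho_x]$, split $\mathcal{Z}$ into $\mathcal{T}:=\{z\in\mathcal{Z}:\rho(x,z)\ge\tau\}$ and $\overline{\mathcal{T}}:=\mathcal{Z}\setminus\mathcal{T}$. Then $$\frac{|\mathcal{T}|}{|\mathcal{T}|+|\overline{\mathcal{T}}|\exp\left(-\frac{\epsilon c}{2\Delta}\right)}\le\Pr[\mathcal{E}_{\epsilon,\rho}(x)\in\mathcal{T}]\le\frac{|\mathcal{T}|}{|\mathcal{T}|+|\overline{\mathcal{T}}|\exp\left(-\frac{\epsilon\bar\Delta}{2\Delta}\right)},$$ where $c:=\tau-\max_{z\in\overline{\mathcal{T}}}\rho(x,z)$ is the difference between $\tau$ and the next lower rating score, and $\bar\Delta:=\hat\rho_x-\check\rho_x$. (If $\overline{\mathcal{T}}=\emptyset$, the terms containing the factor $|\overline{\mathcal{T}}|$ are read as $0$.)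
   Context: **Adjacency and sensitivity.** $\mathcal{X}$ carries a metric $d_{\mathcal{X}}$; inputs $x_1,x_2\in\mathcal{X}$ are adjacent, written $x_1\sim x_2$, if $d_{\mathcal{X}}(x_1,x_2)\le1$. The sensitivity of $\rho$ is $\Delta=\max_{z\in\mathcal{Z}}\max_{x_1\sim x_2}\big(\rho(x_1,z)-\rho(x_2,z)\big)$, where the maximum is assumed to exist. **Exponential mechanism.** For $x\in\mathcal{X}$, $\mathcal{E}_{\epsilon,\rho}(x)$ is the $\mathcal{Z}$-valued random variable with $$\Pr[\mathcal{E}_{\epsilon,\rho}(x)=z]=\frac{\exp\left(\frac{\epsilon}{2\Delta}\rho(x,z)\right)}{\sum_{z'\in\mathcal{Z}}\exp\left(\frac{\epsilon}{2\Delta}\rho(x,z')\right)}.$$ *)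

(* Defs.v *)
From HB Require Import structures.
From mathcomp Require Import all_boot all_order all_algebra.
From mathcomp Require Import all_classical all_reals all_analysis.

Set Implicit Arguments.
Unset Strict Implicit.
Unset Printing Implicit Defensive.

Import Order.TTheory GRing.Theory Num.Theory.
Import numFieldNormedType.Exports.

Local Open Scope classical_set_scope.
Local Open Scope ring_scope.

(* The finite type Z with the sigma-algebra of all its subsets, so that a
   Z-valued random variable on a probability space (Omega, P) is a term of type
   {RV P >-> discrete_fin z0}. The element z0 is only there because a
   measurableType must be pointed. *)
Definition discrete_fin (Z : finType) (z0 : Z) : Type := Z.

HB.instance Definition _ (Z : finType) (z0 : Z) := Finite.on (discrete_fin z0).
HB.instance Definition _ (Z : finType) (z0 : Z) :=
  isPointed.Build (discrete_fin z0) z0.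
HB.instance Definition _ (Z : finType) (z0 : Z) :=
  @isMeasurable.Build default_measure_display (discrete_fin z0)
    (@discrete_measurable Z) (@discrete_measurable0 Z)
    (@discrete_measurableC Z) (@discrete_measurableU Z).

Section MaxMin.
Context {R : realType} {Z : finType}.
Implicit Types (A : {set Z}) (f : Z -> R).

(* The value 0 for the empty set is a dummy. *)
Definition set_max A f : R :=
  if [pick z in A] is Some z0 then \big[Num.max/f z0]_(z in A) f z else 0.

Definition set_min A f : R :=
  if [pick z in A] is Some z0 then \big[Num.min/f z0]_(z in A) f z else 0.

Lemma set_maxP A f z0 : z0 \in A ->
  (exists2 z, z \in A & set_max A f = f z) /\
  (forall z, z \in A -> f z <= set_max A f).
Proof.
rewrite /set_max; case: pickP => [z1 Az1 _|A0]; last by rewrite A0.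
split=> [|z Az]; last exact: le_bigmax_cond.
apply: (big_ind (fun r => exists2 z, z \in A & r = f z)); first by exists z1.
- by move=> r1 r2 [a Aa ->] [b Ab ->]; case: leP; [exists b|exists a].
- by move=> z Az; exists z.
Qed.

Lemma set_minP A f z0 : z0 \in A ->
  (exists2 z, z \in A & set_min A f = f z) /\
  (forall z, z \in A -> set_min A f <= f z).
Proof.
rewrite /set_min; case: pickP => [z1 Az1 _|A0]; last by rewrite A0.
split=> [|z Az]; last exact: bigmin_le_cond.
apply: (big_ind (fun r => exists2 z, z \in A & r = f z)); first by exists z1.
- by move=> r1 r2 [a Aa ->] [b Ab ->]; case: leP; [exists a|exists b].
- by move=> z Az; exists z.
Qed.

End MaxMin.

Section ExponentialMechanism.
Context {R : realType} {X : metricType R} {Z : finType}.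
Implicit Types (rho : X -> Z -> R) (x : X).

Definition adjacent (x1 x2 : X) : Prop := mdist x1 x2 <= 1.

(* Delta is the maximum (attained, not just a supremum) of the rating
   differences over all z and all adjacent x1, x2. *)
Definition is_sensitivity rho (Delta : R) : Prop :=
  let D := [set d | exists z x1 x2,
                      adjacent x1 x2 /\ d = rho x1 z - rho x2 z] in
  D Delta /\ ubound D Delta.

Definition expmech_pmf (eps Delta : R) rho x (z : Z) : R :=
  expR (eps / (2 * Delta) * rho x z) /
  \sum_(z' : Z) expR (eps / (2 * Delta) * rho x z').

(* Only the law of the random variable is prescribed, the probability space
   that carries it is arbitrary. *)
Definition is_expmech d (Omega : measurableType d) (P : probability Omega R)
    (eps Delta : R) rho x (z0 : Z) (E : {RV P >-> discrete_fin z0}) : Prop :=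
  forall z : Z, P [set w | E w = z] = (expmech_pmf eps Delta rho x z)%:E.

End ExponentialMechanism.

(* Main.v *)
Require Import Defs.
From mathcomp Require Import all_boot all_order all_algebra.
From mathcomp Require Import all_classical all_reals all_analysis.

Set Implicit Arguments.
Unset Strict Implicit.

Import Order.TTheory GRing.Theory Num.Theory.
Import numFieldNormedType.Exports.

Local Open Scope classical_set_scope.
Local Open Scope ring_scope.

(* The probability of [T] is [A / (A + B)], where [A] and [B] are the total
   exponential weights of [T] and its complement. Replacing each weight by an
   extreme one bounds [A] and [B] by multiples of the cardinals, and
   [a / (a + b)] depends only on the ratio [b / a], in which it is monotone. *)

(** After cross-multiplication both sides contain [a * a'], and cancelling it leaves exactly the
    last hypothesis. The comparison of ratios is put in product form, with [b] and [b'] allowed to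
    vanish, so that an empty complement needs no separate case. *)
Lemma ler_frac_share (R : realFieldType) (a b a' b' : R) :
  0 < a -> 0 < a' -> 0 <= b -> 0 <= b' -> a * b' <= a' * b ->
  a / (a + b) <= a' / (a' + b').
Proof.
move=> a0 a0' b0 b0' h.
rewrite ler_pdivrMr ?ltr_wpDr// mulrAC ler_pdivlMr ?ltr_wpDr//.
by rewrite !mulrDr [a' * a]mulrC lerD2l.
Qed.

Lemma sum_expR_le (R : realType) (Z : finType) (A : {set Z}) (f : Z -> R)
    (m : R) : {in A, forall z, f z <= m} ->
  \sum_(z in A) expR (f z) <= #|A|%:R * expR m.
Proof.
move=> fm; rewrite mulr_natl -sumr_const.
by apply: ler_sum => z zA; rewrite ler_expR fm.
Qed.

Lemma sum_expR_ge (R : realType) (Z : finType) (A : {set Z}) (f : Z -> R)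
    (m : R) : {in A, forall z, m <= f z} ->
  #|A|%:R * expR m <= \sum_(z in A) expR (f z).
Proof.
move=> fm; rewrite mulr_natl -sumr_const.
by apply: ler_sum => z zA; rewrite ler_expR fm.
Qed.

(** The law of [E] is prescribed on points only. The event is a finite disjoint union of fibres of
    [E], each measurable because every subset of [discrete_fin z0] is, so additivity applies. *)
Lemma expmech_prob_in (R : realType) (X : metricType R) (Z : finType)
    (eps Delta : R) (rho : X -> Z -> R) (z0 : Z) (x : X)
    (d : measure_display) (Omega : measurableType d) (P : probability Omega R)
    (E : {RV P >-> discrete_fin z0}) (A : {set Z}) :
  is_expmech eps Delta rho x E ->
  P [set w | E w \in A] = (\sum_(z in A) expmech_pmf eps Delta rho x z)%:E.
Proof.
move=> EP; rewrite -sumEFin -big_enum/=.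
have -> : [set w | E w \in A] =
    \bigcup_(z in [set` enum A]) [set w | E w = z].
  apply/seteqP; split=> [w EA|w [z /=]]; last by rewrite mem_enum => zA ->.
  by exists (E w) => //=; rewrite mem_enum.
rewrite measure_fin_bigcup.
- by rewrite -fsbig_seq ?enum_uniq//; apply: eq_bigr => z _; exact: EP.
- exact: finite_seq.
- by move=> z1 z2 _ _ [w [/= <- <-]].
- move=> z _; rewrite -[X in measurable X]setTI.
  exact: (measurable_funP E measurableT [set z]).
Qed.

Theorem theorem3p6 (R : realType) (X : metricType R) (Z : finType)
    (eps Delta : R) (rho : X -> Z -> R)
    (eps_gt0 : 0 < eps) (z0 : Z)
    (Delta_sens : is_sensitivity rho Delta) (Delta_gt0 : 0 < Delta)
    (x : X)
    (d : measure_display) (Omega : measurableType d) (P : probability Omega R)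
    (E : {RV P >-> discrete_fin z0}) (E_mech : is_expmech eps Delta rho x E)
    (tau : R) :
  let rho_hat := set_max [set: Z]%SET (rho x) in
  let rho_check := set_min [set: Z]%SET (rho x) in
  let T := [set z | tau <= rho x z]%SET in
  let Tbar := (~: T)%SET in
  let c := tau - set_max Tbar (rho x) in
  let Delta_bar := rho_hat - rho_check in
  rho_check <= tau <= rho_hat ->
  ((#|T|%:R /
      (#|T|%:R + #|Tbar|%:R * expR (- (eps * c / (2 * Delta)))))%:E
     <= P [set w | E w \in T])%E /\
  (P [set w | E w \in T]
     <= (#|T|%:R /
          (#|T|%:R + #|Tbar|%:R * expR (- (eps * Delta_bar / (2 * Delta)))))%:E)%E.
Proof.
move=> rho_hat rho_check T Tbar c Delta_bar /andP[_ tau_le].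
have [[zm _ rho_zm] rho_le] :=
  set_maxP (A := [set: Z]%SET) (rho x) (finset.in_setT z0).
have [_ rho_ge] := set_minP (A := [set: Z]%SET) (rho x) (finset.in_setT z0).
set k := eps / (2 * Delta).
have k_ge0 : 0 <= k by rewrite divr_ge0 ?mulr_ge0// ltW.
have kE r : eps * r / (2 * Delta) = k * r by rewrite mulrAC.
(* The upper bound on [tau] enters here: a maximiser of the rating lies in [T], so [T] is
   nonempty. *)
have zmT : zm \in T by rewrite inE -rho_zm.
have T_gt0 : 0 < #|T|%:R :> R by rewrite ltr0n; apply/card_gt0P; exists zm.
pose A := \sum_(z in T) expR (k * rho x z).
pose B := \sum_(z in Tbar) expR (k * rho x z).
have B_ge0 : 0 <= B by apply: sumr_ge0 => z _; exact: expR_ge0.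
have A_gt0 : 0 < A.
  apply: lt_le_trans (sum_expR_ge (m := k * tau) _).
    by rewrite mulr_gt0 ?expR_gt0.
  by move=> z; rewrite inE => tz; rewrite ler_wpM2l.
have u_ge0 r : 0 <= #|Tbar|%:R * expR r :> R by rewrite mulr_ge0 ?expR_ge0.
(* The normalising sum splits along [T] and its complement. *)
have -> : P [set w | E w \in T] = (A / (A + B))%:E.
  rewrite (expmech_prob_in _ E_mech) -mulr_suml; congr (_ / _)%:E.
  rewrite (bigID (mem T))/=; congr (_ + _).
  by apply: eq_bigl => z; rewrite finset.in_setC.
rewrite !lee_fin !kE; split; apply: ler_frac_share => //.
(* Lower bound: [B] is at most [#|Tbar| * expR (k * M)], [A] is at least [#|T| * expR (k * tau)],
   and [M = tau - c]. If [Tbar] is empty, the dummy value of [M] is harmless, being multiplied by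
   [#|Tbar| = 0]. *)
- set M := set_max Tbar (rho x) in c *.
  apply: (@le_trans _ _ (#|T|%:R * (#|Tbar|%:R * expR (k * M)))).
    rewrite ler_wpM2l//; apply: sum_expR_le => z zT.
    by rewrite ler_wpM2l//; case: (set_maxP (rho x) zT) => _; exact.
  have -> : expR (k * M) = expR (k * tau) * expR (- (k * c)).
    by rewrite -expRD -mulrN -mulrDr opprB addrC subrK.
  rewrite (mulrCA #|Tbar|%:R) [leLHS]mulrA ler_wpM2r//.
  apply: sum_expR_ge => z; rewrite inE => tz; exact: ler_wpM2l.
(* Upper bound: every weight in [A] is raised to the one at [rho_hat]. The factor with [Delta_bar]
   turns it into the weight at [rho_check], which is below every weight in [B]. *)
- apply: (@le_trans _ _ (#|T|%:R * expR (k * rho_hat) *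
    (#|Tbar|%:R * expR (- (k * Delta_bar))))).
    rewrite ler_wpM2r//; apply: sum_expR_le => z _.
    by rewrite ler_wpM2l// rho_le ?finset.in_setT.
  rewrite -mulrA ler_wpM2l// mulrCA -expRD -mulrN -mulrDr opprB addrC subrK.
  by apply: sum_expR_ge => z _; rewrite ler_wpM2l// rho_ge ?finset.in_setT.
Qed.
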